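(* Let $n>1$ and let $(X_j)_{j\ge1}$ be independent and identically distributed random variables on a probability space $(\Omega,\mathcal{F},\mathbb{P})$ with values in $\{a_1,a_2,\dots,a_n\}\subseteq K_n$. For $i\in[n]$ put $p_i=\mathbb{P}(X_1=a_i)$ and $q_i=1-p_i$. Let $P_0=e$, $P_j=X_1X_2\cdots X_j$ (product in $K_n$) for $j\ge1$, and $L_j=\mathcal{L}(P_j)$ for $j\ge0$. Then $(L_j)_{j\ge0}$ is a (time-homogeneous) Markov chain with state space $\{0,1,\dots,n\}$, with initial distribution $\pi=(0,0,\dots,0,1)$ (i.e. $\mathbb{P}(L_0=n)=1$), and with transition probability matrix $\mathcal{P}=(\mathcal{P}_{i,j})_{0\le i,j\le n}$ given by $\mathcal{P}_{0,0}=1$, $\mathcal{P}_{0,j}=0$ for $j\ge 1$, and, for $1\le i\le n$, \[ \mathcal{P}_{i,i-1}=p_i,\qquad \mathcal{P}_{i,i}=q_i,\qquad \mathcal{P}_{i,j}=0\ \text{ for } j\notin\{i-1,i\}. \]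
   Context: For a natural number $k$, $[k]=\{1,\dots,k\}$, and $[0]=\emptyset$. Kiselman's semigroup $K_n$ is the monoid, with unit element $e$, given by generators $a_1,\dots,a_n$ and relations $a_i^2=a_i$ for all $i\in[n]$, and $a_i a_j a_i = a_j a_i a_j = a_i a_j$ for all $1\le j<i\le n$. For $X\subseteq[n]$, write $X=\{i_1>i_2>\dots>i_k\}$ and set $e_X=a_{i_1}a_{i_2}\cdots a_{i_k}$, with $e_\emptyset=e$. For $X\subseteq[n]$, the deletion endomorphism $\overline{\partial}_X:K_n\to K_n$ is the unique monoid endomorphism with $\overline{\partial}_X(a_i)=a_i$ if $i\notin X$ and $\overline{\partial}_X(a_i)=e$ if $i\in X$. The level function $\mathcal{L}:K_n\to\{0,1,\dots,n\}$ is defined by \[ \mathcal{L}(x)=\min\{i\in\{0,1,\dots,n\}\mid \overline{\partial}_{[i]}(x)=e_{[n]\setminus[i]}\} \] (the set contains $n$, so the minimum exists). *)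

(* Defs.v *)
From HB Require Import structures.
From mathcomp Require Import all_boot all_order all_algebra finmap generic_quotient.
From mathcomp Require Import all_classical all_reals all_analysis.

Set Implicit Arguments.
Unset Strict Implicit.
Unset Printing Implicit Defensive.

Import Order.TTheory GRing.Theory Num.Theory.

Local Open Scope quotient_scope.

(* The generator a_{k+1} is indexed by k : 'I_n, so the index set {1, ..., n}
   is shifted to {0, ..., n-1}; its order is unchanged. *)

Inductive kis_rel (n : nat) : seq 'I_n -> seq 'I_n -> Prop :=
| kis_idem i : kis_rel [:: i; i] [:: i]
| kis_iji (i j : 'I_n) : (j < i)%N -> kis_rel [:: i; j; i] [:: i; j]
| kis_jij (i j : 'I_n) : (j < i)%N -> kis_rel [:: j; i; j] [:: i; j].

Inductive kis_cong (n : nat) : seq 'I_n -> seq 'I_n -> Prop :=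
| kis_base u v : kis_rel u v -> kis_cong u v
| kis_refl u : kis_cong u u
| kis_sym u v : kis_cong u v -> kis_cong v u
| kis_trans v u w : kis_cong u v -> kis_cong v w -> kis_cong u w
| kis_cat u u' v v' :
    kis_cong u u' -> kis_cong v v' -> kis_cong (u ++ v) (u' ++ v').

Definition kis_eqb (n : nat) : rel (seq 'I_n) := fun u v => `[< kis_cong u v >].

Lemma kis_eqb_refl n : reflexive (@kis_eqb n).
Proof. by move=> u; apply/asboolP; exact: kis_refl. Qed.

Lemma kis_eqb_sym n : symmetric (@kis_eqb n).
Proof. by move=> u v; apply/asboolP/asboolP; exact: kis_sym. Qed.

Lemma kis_eqb_trans n : transitive (@kis_eqb n).
Proof.
by move=> v u w /asboolP uv /asboolP vw; apply/asboolP; exact: kis_trans uv vw.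
Qed.

Canonical kis_equiv n :=
  EquivRel (@kis_eqb n) (@kis_eqb_refl n) (@kis_eqb_sym n) (@kis_eqb_trans n).

Definition kiselman (n : nat) := {eq_quot (@kis_equiv n)}.

HB.instance Definition _ n := Choice.on (kiselman n).

Section KiselmanMonoid.
Variable n : nat.
Implicit Types (u v : seq 'I_n) (x y z : kiselman n) (X : {set 'I_n}).

Definition kis_word u : kiselman n := \pi u.

Definition kis_rep x : seq 'I_n := repr x.

Lemma kis_repK : cancel kis_rep kis_word.
Proof. exact: reprK. Qed.

Lemma kis_wordP u v : kis_word u = kis_word v <-> kis_cong u v.
Proof.
split; first by move/eqmodP/asboolP.
by move=> uv; apply/eqmodP/asboolP.
Qed.

Lemma kis_rep_word u : kis_cong (kis_rep (kis_word u)) u.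
Proof. by apply/kis_wordP; rewrite kis_repK. Qed.

Definition kis_mul x y : kiselman n := kis_word (kis_rep x ++ kis_rep y).

Lemma kis_mul_word u v : kis_mul (kis_word u) (kis_word v) = kis_word (u ++ v).
Proof. by apply/kis_wordP; apply: kis_cat; exact: kis_rep_word. Qed.

Lemma kis_mulA : associative kis_mul.
Proof.
move=> x y z; rewrite -[x]kis_repK -[y]kis_repK -[z]kis_repK.
by rewrite !kis_mul_word catA.
Qed.

Lemma kis_mul1 : left_id (kis_word [::]) kis_mul.
Proof. by move=> x; rewrite -[x]kis_repK kis_mul_word. Qed.

Lemma kis_mulr1 : right_id (kis_word [::]) kis_mul.
Proof. by move=> x; rewrite -[x]kis_repK kis_mul_word cats0. Qed.

HB.instance Definition _ :=
  isMonoid.Build (kiselman n) kis_mulA kis_mul1 kis_mulr1.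

Lemma kis_wordM u v : kis_word (u ++ v) = (kis_word u * kis_word v)%g.
Proof. by rewrite -kis_mul_word. Qed.

Lemma kis_word1 : kis_word [::] = 1%g.
Proof. by []. Qed.

Definition gen (i : 'I_n) : kiselman n := kis_word [:: i].

Lemma kis_word_prod u : kis_word u = (\prod_(i <- u) gen i)%g.
Proof.
elim: u => [|i u IH]; first by rewrite big_nil.
by rewrite big_cons -IH -kis_wordM.
Qed.

Lemma gen_idem i : (gen i * gen i = gen i)%g.
Proof.
by rewrite -kis_wordM; apply/kis_wordP/kis_base; exact: kis_idem.
Qed.

Lemma gen_iji (i j : 'I_n) : (j < i)%N -> (gen i * gen j * gen i = gen i * gen j)%g.
Proof.
move=> ji; rewrite -[(gen i * gen j)%g]kis_wordM -kis_wordM.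
by apply/kis_wordP/kis_base; exact: kis_iji.
Qed.

Lemma gen_jij (i j : 'I_n) : (j < i)%N -> (gen j * gen i * gen j = gen i * gen j)%g.
Proof.
move=> ji; rewrite -[(gen i * gen j)%g]kis_wordM.
rewrite -[(gen j * gen i)%g]kis_wordM -kis_wordM.
by apply/kis_wordP/kis_base; exact: kis_jij.
Qed.

(* [enum X] is increasing, hence the product is taken in decreasing order. *)
Definition eX X : kiselman n := (\prod_(i <- rev (enum X)) gen i)%g.

Definition del X x : kiselman n :=
  kis_word [seq i <- kis_rep x | i \notin X].

Lemma kis_cong_filter X u v : kis_cong u v ->
  kis_cong [seq i <- u | i \notin X] [seq i <- v | i \notin X].
Proof.
elim=> {u v} [u v uv|u|u v _|v u w _ uv _ vw|u u' v v' _ uu _ vv].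
- case: uv => [i|i j ji|i j ji] /=; case: (i \in X) => /=;
    try (case: (j \in X) => /=); try exact: kis_refl;
    by apply: kis_base; by constructor.
- exact: kis_refl.
- exact: kis_sym.
- exact: kis_trans uv vw.
- by rewrite !filter_cat; exact: kis_cat.
Qed.

Lemma del_word X u : del X (kis_word u) = kis_word [seq i <- u | i \notin X].
Proof. by apply/kis_wordP; apply: kis_cong_filter; exact: kis_rep_word. Qed.

Lemma del_monoid_morphism X : monoid.monoid_morphism (del X).
Proof.
split; first by rewrite -kis_word1 del_word.
move=> x y; rewrite -[x]kis_repK -[y]kis_repK -kis_wordM !del_word.
by rewrite filter_cat kis_wordM.
Qed.

HB.instance Definition _ X :=
  isUMagmaMorphism.Build (kiselman n) (kiselman n) (del X)
    (del_monoid_morphism X).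

Lemma del_gen X i : del X (gen i) = if i \in X then 1%g else gen i.
Proof. by rewrite del_word /=; case: (i \in X). Qed.

Lemma del_unique X (f : kiselman n -> kiselman n) : monoid.monoid_morphism f ->
  (forall i, f (gen i) = if i \in X then 1%g else gen i) -> f =1 del X.
Proof.
move=> [f1 fM] fg x; rewrite -[x]kis_repK.
elim: (kis_rep x) => [|i u IH]; first by rewrite del_word /= kis_word1.
rewrite -cat1s kis_wordM fM IH fg.
by rewrite (del_monoid_morphism X).2 del_gen.
Qed.

(* The set [i] = {1, ..., i} after the index shift. *)
Definition initial (i : nat) : {set 'I_n} := [set k : 'I_n | (k < i)%N].

Definition at_level x (i : 'I_n.+1) : bool :=
  del (initial i) x == eX (~: initial i).

Lemma at_level_max x : at_level x ord_max.
Proof.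
apply/eqP; have -> : initial (@ord_max n) = finset.setTfor 'I_n.
  by apply/finset.setP => k; rewrite !inE ltn_ord.
rewrite finset.setCT /eX enum_set0 big_nil /del (eq_filter (a2 := pred0)).
  by rewrite filter_pred0.
by move=> k; rewrite inE.
Qed.

Definition level x : 'I_n.+1 :=
  [arg min_(i < ord_max | at_level x i) (i : nat)]%N.

Lemma levelP x :
  at_level x (level x) /\ forall i, at_level x i -> (level x <= i)%N.
Proof. by rewrite /level; case: arg_minnP => //; exact: at_level_max. Qed.

HB.instance Definition _ := isPointed.Build (kiselman n) 1%g.

HB.instance Definition _ := @isMeasurable.Build default_measure_display
  (kiselman n) discrete_measurable discrete_measurable0
  discrete_measurableC discrete_measurableU.

End KiselmanMonoid.

Local Open Scope classical_set_scope.
Local Open Scope ring_scope.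

Section Probability.
Context {R : realType} {d : measure_display} {T : measurableType d}.
Variable P : probability T R.

Definition mutually_independent {d'} {T' : measurableType d'}
    (X : nat -> {RV P >-> T'}) : Prop :=
  forall (J : {fset nat}) (A : nat -> set T'), (forall j, measurable (A j)) ->
    P (\bigcap_(j in [set` J]) (X j @^-1` A j)) =
    (\prod_(j <- J) P (X j @^-1` A j))%E.

Definition identically_distributed {d'} {T' : measurableType d'}
    (X : nat -> {RV P >-> T'}) : Prop :=
  forall (i j : nat) (A : set T'), measurable A ->
    distribution P (X i) A = distribution P (X j) A.

Definition cond_prob (A B : set T) : R := fine (P (A `&` B)) / fine (P B).

(* Conditional probabilities are only constrained when the conditioning event
   has positive probability. *)
Record markov_chain (m : nat) (Y : nat -> T -> 'I_m)
    (pi : 'rV[R]_m) (Q : 'M[R]_m) : Prop := MarkovChain {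
  mc_measurable : forall k s, measurable (Y k @^-1` [set s]);
  mc_init_ge0 : forall s, 0 <= pi ord0 s;
  mc_init_sum : \sum_s pi ord0 s = 1;
  mc_trans_ge0 : forall s t, 0 <= Q s t;
  mc_trans_sum : forall s, \sum_t Q s t = 1;
  mc_init : forall s, P (Y 0%N @^-1` [set s]) = (pi ord0 s)%:E;
  mc_step : forall (k : nat) (s : nat -> 'I_m),
    let past := [set w | forall j, (j <= k)%N -> Y j w = s j] in
    (0 < P past)%E ->
    cond_prob (Y k.+1 @^-1` [set s k.+1]) past = Q (s k) (s k.+1)
}.

(* [X j] stands for X_{j+1}. *)
Definition walk (n : nat) (X : nat -> T -> kiselman n) (j : nat) (w : T) :
    kiselman n := (\prod_(i < j) X i w)%g.

End Probability.

Definition level_init (R : realType) (n : nat) : 'rV[R]_n.+1 :=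
  \row_j (j == ord_max)%:R.

(* [unlift ord0 i] is [None] if i = 0 and [Some k] with i = k + 1 otherwise;
   [p k] is the probability of the generator with (one-based) index i. *)
Definition level_trans (R : realType) (n : nat) (p : 'I_n -> R) : 'M[R]_n.+1 :=
  \matrix_(i, j)
    if unlift ord0 i is Some k then
      if j == k :> nat then p k else if j == i then 1 - p k else 0
    else (j == ord0)%:R.

(* Main.v *)
(** Reading a word over a_1, ..., a_n from left to right, keep a counter that
starts at n and drops from l to l - 1 exactly when the letter a_l is read.
This is compatible with the defining relations, so it is a right action of K_n
on the naturals, and L(x) turns out to be n acted upon by x.  Hence
L_{j+1} is L_j acted upon by X_{j+1}, and the event that (L_0, ..., L_k)
follows a given path is empty or an intersection of events [X_j \in B_j],
to which independence applies directly. *)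
Require Import Defs.
From mathcomp Require Import all_boot all_order all_algebra finmap.
From mathcomp Require Import all_classical all_reals all_analysis.
From mathcomp Require Import zify.

Import Order.TTheory GRing.Theory Num.Theory.

Local Open Scope classical_set_scope.
Local Open Scope ring_scope.

(** * The counter as a right action of K_n on the naturals *)

Section LevelAction.
Set Implicit Arguments.
Unset Strict Implicit.
Variable n : nat.
Implicit Types (u v : seq 'I_n) (x y : kiselman n) (i j k : 'I_n) (l : nat).

(** With zero-based indices the letter [k] is a_{k+1}, so it takes the counter from [k.+1] to
    [k]. *)
Definition lower l k : nat := if l == k.+1 then nat_of_ord k else l.

Lemma lower_le l k : (lower l k <= l)%N.
Proof. by rewrite /lower; case: eqP => // ->. Qed.

Lemma lower_homo k : {homo lower^~ k : l l' / (l <= l')%N}.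
Proof. by move=> l l'; rewrite /lower; case: eqP; case: eqP; lia. Qed.

(** Each defining relation is checked by comparing [l] with the shifted indices; this makes the
    counter well defined on K_n. *)
Lemma foldl_lower_cong u v : kis_cong u v ->
  forall l, foldl lower l u = foldl lower l v.
Proof.
elim=> {u v} [u v []|u|u v _ IH|v u w _ IH1 _ IH2|u u' v v' _ IH1 _ IH2] //.
- by move=> i l; rewrite /= /lower; do !case: eqP; lia.
- by move=> i j ji l; rewrite /= /lower; do !case: eqP; lia.
- by move=> i j ji l; rewrite /= /lower; do !case: eqP; lia.
- by move=> l; rewrite IH1 IH2.
- by move=> l; rewrite !foldl_cat IH1 IH2.
Qed.

(** Every [lower^~ k] is monotone and never raises the counter, so erasing letters can only leave
    the counter higher. This yields the minimality of the level. *)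
Lemma foldl_lower_filter (Q : pred 'I_n) u l l' : (l <= l')%N ->
  (foldl lower l u <= foldl lower l' [seq k <- u | Q k])%N.
Proof.
elim: u l l' => //= k u IH l l' ll'; case: (Q k) => /=; apply: IH.
  exact: lower_homo.
exact: leq_trans (lower_le _ _) ll'.
Qed.

Definition level_act l x : nat := foldl lower l (kis_rep x).

Lemma level_act_word l u : level_act l (kis_word u) = foldl lower l u.
Proof. exact/foldl_lower_cong/kis_rep_word. Qed.

Lemma level_act_gen l i : level_act l (gen i) = lower l i.
Proof. by rewrite level_act_word. Qed.

Lemma level_act1 l : level_act l 1%g = l.
Proof. by rewrite -kis_word1 level_act_word. Qed.

Lemma level_actM l x y : level_act l (x * y)%g = level_act (level_act l x) y.
Proof.
rewrite -[x]kis_repK -[y]kis_repK -kis_wordM.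
by rewrite !level_act_word foldl_cat.
Qed.

(** * Absorption of letters and the decreasing words *)

Lemma kis_word_cons i u : kis_word (i :: u) = (gen i * kis_word u)%g.
Proof. by rewrite -cat1s kis_wordM. Qed.

Lemma kis_word_rcons u i : kis_word (rcons u i) = (kis_word u * gen i)%g.
Proof. by rewrite -cats1 kis_wordM. Qed.

(** By induction a further a_i may be inserted just after the first letter a_j of the word; then a_i
    a_j a_i = a_j a_i for i < j. *)
Lemma gen_word_absorb i u : {in u, forall j, i < j}%N ->
  (gen i * kis_word u * gen i = kis_word u * gen i)%g.
Proof.
elim: u => [|j u IH] iu; first by rewrite mulg1 gen_idem mul1g.
have ij : (i < j)%N by apply: iu; rewrite mem_head.
have {}IH : (gen i * kis_word u * gen i = kis_word u * gen i)%g.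
  by apply: IH => k ku; apply: iu; rewrite inE ku orbT.
rewrite kis_word_cons -!mulgA -IH !mulgA gen_jij//.
Qed.

(* The letter i may be erased wherever only larger letters separate it from a
   final i. *)
Lemma filter_gen i u : {in u, forall j, i <= j}%N ->
  (kis_word u * gen i = kis_word [seq j <- u | j != i] * gen i)%g.
Proof.
elim: u => // j u IH iu.
have {}IH : (kis_word u * gen i = kis_word [seq j <- u | j != i] * gen i)%g.
  by apply: IH => k ku; apply: iu; rewrite inE ku orbT.
rewrite kis_word_cons -mulgA IH /=; case: eqVneq => [->|ji].
  rewrite mulgA gen_word_absorb// => k.
  rewrite mem_filter => /andP[ki ku]; rewrite ltn_neqAle eq_sym ki.
  by apply: iu; rewrite inE ku orbT.
by rewrite kis_word_cons mulgA.
Qed.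

(** A word for e_{[n]\[l]}: the zero-based indices from [l] on are those of a_{l+1}, ..., a_n. *)
Definition decr l : seq 'I_n := rev [seq k : 'I_n <- enum 'I_n | l <= k]%N.

Lemma eX_setC_initial l : eX (~: initial n l) = kis_word (decr l).
Proof.
rewrite /eX -kis_word_prod /decr; congr (kis_word (rev _)).
by rewrite enumT /enum_mem; apply: eq_filter => k; rewrite !inE -leqNgt.
Qed.

Lemma decr_max : decr n = [::].
Proof.
rewrite /decr (eq_filter (a2 := pred0)) ?filter_pred0// => k.
by rewrite /= leqNgt ltn_ord.
Qed.

Lemma decrS k : decr k = rcons (decr k.+1) k.
Proof.
have val_filter l : (l <= n)%N ->
    map val [seq j : 'I_n <- enum 'I_n | l <= j]%N = iota l (n - l).
  move=> ln; rewrite -(filter_map val (leq l)) val_enum_ord -{1}(subnKC ln).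
  rewrite iotaD filter_cat add0n (eq_in_filter (a2 := pred0)).
    rewrite filter_pred0; apply/all_filterP/allP => j.
    by rewrite mem_iota => /andP[].
  by move=> j; rewrite mem_iota /= add0n ltnNge => /negbTE.
rewrite /decr -rev_cons; congr rev; apply: (inj_map val_inj) => /=.
by rewrite !val_filter ?ltn_ord// 1?ltnW// subnS -[(n - k)%N]prednK// subn_gt0.
Qed.

(** Induction on n - l. In the step [k] ranges over ['I_n], so that it is a letter and [decrS]
    applies. *)
Lemma downward_ind (Q : nat -> Prop) : Q n -> (forall k, Q k.+1 -> Q k) ->
  forall l, (l <= n)%N -> Q l.
Proof.
move=> Qn QS l ln; rewrite -(subKn ln).
elim: (n - l)%N (leq_subr l n) => [|m IH] mn; first by rewrite subn0.
have lt_n : (n - m.+1 < n)%N by lia.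
apply: (QS (Ordinal lt_n)); rewrite /= subnSK//; exact/IH/ltnW.
Qed.

Lemma foldl_lower_decr l : (l <= n)%N -> foldl lower n (decr l) = l.
Proof.
move: l; apply: downward_ind => [|k IH]; first by rewrite decr_max.
by rewrite decrS foldl_rcons IH /lower eqxx.
Qed.

(** The letter a_i already occurs in [decr l], followed only by smaller letters, and a_i a_k a_i =
    a_i a_k for k < i. *)
Lemma decr_gen l i : (l <= i)%N ->
  (kis_word (decr l) * gen i = kis_word (decr l))%g.
Proof.
move=> li; have ln := leq_trans li (ltnW (ltn_ord i)).
move: l ln li; apply: downward_ind => [|k IH ki]; first by rewrite leqNgt ltn_ord.
rewrite decrS kis_word_rcons.
move: ki; rewrite leq_eqVlt => /predU1P[/val_inj <-|ki].
  by rewrite -mulgA gen_idem.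
(* The induction hypothesis, read backwards, puts a copy of a_i in front of a_k. *)
by rewrite -(IH ki) -!mulgA (mulgA (gen i)) gen_iji// !mulgA.
Qed.

(** * The level as the counter started at n *)

Lemma notin_initial l k : (k \notin initial n l) = (l <= k)%N.
Proof. by rewrite inE -leqNgt. Qed.

(** Induction on the last letter [i]. If the counter drops from [i.+1] to [i], the letter [i] is no
    longer deleted, and [filter_gen] erases all its copies but the last. Otherwise the new letter is
    absorbed by [decr_gen] or deleted. *)
Lemma del_initial_word u :
  let l := foldl lower n u in del (initial n l) (kis_word u) = kis_word (decr l).
Proof.
elim/last_ind: u => [|u i] /=; first by rewrite del_word /= decr_max.
rewrite foldl_rcons; set l := foldl lower n u => IH.
rewrite del_word filter_rcons notin_initial /lower; case: (eqVneq l i.+1) => [li|li].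
  rewrite leqnn kis_word_rcons filter_gen; last first.
    by move=> j; rewrite mem_filter notin_initial => /andP[].
  rewrite -filter_predI decrS kis_word_rcons -li -IH del_word.
  congr (kis_word _ * _)%g; apply: eq_filter => j.
  by rewrite /= !notin_initial li ltn_neqAle eq_sym.
rewrite del_word in IH; case: leqP => il; last exact: IH.
by rewrite kis_word_rcons IH decr_gen.
Qed.

Lemma at_levelE x (l : 'I_n.+1) :
  at_level x l = (del (initial n l) x == kis_word (decr l)).
Proof. by rewrite /at_level eX_setC_initial. Qed.

Lemma levelE x : level x = level_act n x :> nat.
Proof.
have [] := levelP x; rewrite -[x]kis_repK; move: (kis_rep x) => u {x}.
rewrite at_levelE del_word level_act_word => /eqP/kis_wordP/foldl_lower_cong eq_l.
move=> /(_ (inord (foldl lower n u))) le_l; apply/eqP; rewrite eqn_leq.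
(* Erasing all letters leaves the counter at n; this bound is what [inordK] needs. *)
have un : (foldl lower n u <= n)%N.
  by have := foldl_lower_filter pred0 u (leqnn n); rewrite filter_pred0.
move: le_l; rewrite at_levelE inordK// => -> /=; last exact/eqP/del_initial_word.
(* Minimality: [decr l] takes n to l, and at the level l it acts as a word obtained from [u] by
   erasing letters. *)
rewrite -[leqRHS]foldl_lower_decr ?leq_ord// -eq_l.
exact: foldl_lower_filter.
Qed.

Lemma level1 : level (1%g : kiselman n) = ord_max.
Proof. by apply: val_inj; rewrite /= levelE level_act1. Qed.

Lemma levelM x y : level (x * y)%g = level_act (level x) y :> nat.
Proof. by rewrite !levelE level_actM. Qed.

End LevelAction.

(** * Independence, and the levels along the random walk *)

Section LevelWalk.
Context {R : realType} {d : measure_display} {T : measurableType d}.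
Context {P : probability T R}.

(** Mutual independence is applied to the times up to k and to those before k; the two products
    differ by the factor at k. *)
Lemma independent_last {d'} {T' : measurableType d'} (X : nat -> {RV P >-> T'})
    (k : nat) (A : set T') (B : nat -> set T') :
  mutually_independent X -> measurable A -> (forall j, measurable (B j)) ->
  P (X k @^-1` A `&` \bigcap_(j in `I_k) X j @^-1` B j) =
  (P (X k @^-1` A) * P (\bigcap_(j in `I_k) X j @^-1` B j))%E.
Proof.
move=> indep mA mB; pose J := [fset j in iota 0 k]%fset.
have JE : [set` J] = `I_k.
  by apply/seteqP; split=> j /=; rewrite !inE mem_iota add0n.
have kJ : k \notin J by rewrite !inE mem_iota add0n ltnn.
pose C j := if j == k then A else B j.
have CB j : j \in J -> C j = B j by rewrite /C; case: eqP kJ => // -> /negP.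
have mC j : measurable (C j) by rewrite /C; case: ifP.
have Ck : C k = A by rewrite /C eqxx.
have capE : \bigcap_(j in [set` J]) X j @^-1` C j =
    \bigcap_(j in [set` J]) X j @^-1` B j.
  by apply: eq_bigcapr => j jJ; rewrite CB.
have := indep (k |` J)%fset C mC.
by rewrite bigcap_fsetU1 big_fsetU1//= Ck capE -JE -indep// capE.
Qed.

Context {n : nat} (X : nat -> {RV P >-> kiselman n}).

Definition level_walk j w := level (walk X j w).
Local Notation L := level_walk.

Lemma walkS j w : walk X j.+1 w = (walk X j w * X j w)%g.
Proof. by rewrite /walk big_ord_recr. Qed.

Lemma level_walk0 w : L 0%N w = ord_max.
Proof. by rewrite /level_walk /walk big_ord0 level1. Qed.

Lemma prob_level_walk0 s :
  P (L 0%N @^-1` [set s]) = (level_init R n ord0 s)%:E.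
Proof.
rewrite mxE; have [->|s_max] := eqVneq.
  rewrite (_ : _ @^-1` _ = setT) ?probability_setT//.
  by apply/seteqP; split=> // w _; exact: level_walk0.
rewrite (_ : _ @^-1` _ = set0) ?measure0//; apply/seteqP; split=> // w /=.
by rewrite level_walk0 => /esym/eqP; rewrite (negbTE s_max).
Qed.

Lemma level_walkS j w : L j.+1 w = level_act (L j w) (X j w) :> nat.
Proof. by rewrite /level_walk walkS levelM. Qed.

Definition move_set (s t : 'I_n.+1) : set (kiselman n) :=
  [set x | level_act s x = t].

Lemma level_walkS_preimage j s t :
  (L j @^-1` [set s]) `&` (L j.+1 @^-1` [set t]) =
  (L j @^-1` [set s]) `&` (X j @^-1` move_set s t).
Proof.
apply/seteqP; split=> w [/= Ls Lt]; split=> //=; rewrite /move_set /=.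
  by rewrite -Lt level_walkS Ls.
by apply: val_inj; rewrite /= level_walkS Ls Lt.
Qed.

(** Induction on time, splitting by the previous level; every subset of K_n is measurable. *)
Lemma measurable_level_walk j s : measurable (L j @^-1` [set s]).
Proof.
elim: j s => [|j IH] t.
  rewrite (_ : _ @^-1` _ = if ord_max == t then setT else set0).
    by case: ifP.
  apply/seteqP; split=> w /=; rewrite level_walk0; first by move=> ->; rewrite eqxx.
  by case: eqP.
rewrite (_ : _ @^-1` _ = \bigcup_s
    ((L j @^-1` [set s]) `&` (X j @^-1` move_set s t))).
  apply: countable_bigcupT_measurable => // s; apply: measurableI; first exact: IH.
  exact: measurable_funPTI.
rewrite -[LHS]setTI.
under eq_bigcupr do rewrite -level_walkS_preimage.
rewrite -setI_bigcupl; congr (_ `&` _); apply/esym/seteqP; split=> // w _.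
by exists (L j w).
Qed.

Definition level_past (s : nat -> 'I_n.+1) k :=
  [set w | forall j, (j <= k)%N -> L j w = s j].

Lemma measurable_level_past s k : measurable (level_past s k).
Proof.
rewrite (_ : level_past s k = \bigcap_(j in `I_k.+1) L j @^-1` [set s j]).
  by apply: fin_bigcap_measurable => // j _; exact: measurable_level_walk.
by apply/seteqP; split=> w past j; exact: past.
Qed.

(** This turns the past into an event on the first k steps of the walk alone, the form that
    [independent_last] takes. *)
Lemma level_pastE s k : s 0%N = ord_max ->
  level_past s k = \bigcap_(j in `I_k) X j @^-1` move_set (s j) (s j.+1).
Proof.
move=> s0; apply/seteqP; split=> w.
  move=> past j /= jk; rewrite /move_set /= -!past//; last exact: ltnW.
  exact/esym/level_walkS.
move=> moves; elim=> [|j IH] jk; first by rewrite level_walk0.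
by apply: val_inj; rewrite /= level_walkS IH ?(ltnW jk)//; exact: moves.
Qed.

Lemma level_walkS_past s k t :
  L k.+1 @^-1` [set t] `&` level_past s k =
  X k @^-1` move_set (s k) t `&` level_past s k.
Proof.
have past_sub : level_past s k `<=` L k @^-1` [set s k] by move=> w; exact.
by rewrite -(setIidr past_sub) !setIA ![_ `&` L k @^-1` _]setIC level_walkS_preimage.
Qed.

(** * Transition probabilities of the level process *)

Hypothesis X_gen : forall j w, exists i : 'I_n, X j w = gen i.
Hypothesis X_indep : mutually_independent X.
Hypothesis X_ident : identically_distributed X.

Let p (i : 'I_n) : R := fine (P (X 0%N @^-1` [set gen i])).

Lemma prob_gen k i : P (X k @^-1` [set gen i]) = (p i)%:E.
Proof.
rewrite /p fineK; last by apply: fin_num_measure; exact: measurable_funPTI.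
exact: X_ident.
Qed.

Lemma prob_move k s t :
  P (X k @^-1` move_set s t) = (level_trans p s t)%:E.
Proof.
rewrite /level_trans mxE; case: unliftP => [c|] ->.
  (* The level [lift ord0 c] is c + 1, and only the generator with zero-based index [c] lowers
     it. *)
  have move_gen w : level_act (lift ord0 c) (X k w) =
      if X k w == gen c then c : nat else lift ord0 c.
    have [i ->] := X_gen k w.
    case: eqP => [->|ic]; rewrite level_act_gen /lower lift0 ?eqxx//.
    by case: eqP => // -[/val_inj ci]; case: ic; rewrite ci.
  have [tc|tc] := eqVneq (t : nat) c.
    rewrite -(prob_gen k); congr (P _); apply/seteqP; split=> w;
      rewrite /move_set /= move_gen; case: eqP => // _.
    by rewrite tc lift0 => /eqP; rewrite gtn_eqF.
  have [ts|ts] := eqVneq t (lift ord0 c).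
    rewrite EFinB -(prob_gen k) -probability_setC; last exact: measurable_funPTI.
    congr (P _); apply/seteqP; split=> w;
      rewrite /move_set /= move_gen ts; case: eqP => // _.
    by rewrite lift0 => /eqP; rewrite ltn_eqF.
  rewrite (_ : _ @^-1` _ = set0) ?measure0//; apply/seteqP; split=> // w.
  rewrite /move_set /= move_gen; case: eqP => _ => [/esym/eqP|/esym/val_inj/eqP].
    by rewrite (negbTE tc).
  by rewrite (negbTE ts).
(* No letter lowers 0, so 0 is absorbing. *)
have move0 w : level_act (@ord0 n) (X k w) = 0%N.
  by have [i ->] := X_gen k w; rewrite level_act_gen.
case: eqVneq => [->|t0].
  rewrite (_ : _ @^-1` _ = setT) ?probability_setT//.
  by apply/seteqP; split=> // w _; exact: move0.
rewrite (_ : _ @^-1` _ = set0) ?measure0//; apply/seteqP; split=> // w.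
by rewrite /move_set /= move0 => t_eq0; case/eqP: t0; exact: val_inj.
Qed.

Lemma level_trans_ge0 s t : 0 <= level_trans p s t.
Proof. by rewrite -lee_fin -(prob_move 0%N). Qed.

Lemma level_trans_sum s : \sum_t level_trans p s t = 1.
Proof.
under eq_bigr do rewrite mxE; case: unliftP => [c ->|_].
  (* [c'] is [c] seen as a level; row c + 1 is supported on the columns c and c + 1. *)
  pose c' : 'I_n.+1 := widen_ord (leqnSn n) c.
  have c'E (t : 'I_n.+1) : (t == c :> nat) = (t == c') by [].
  have c's : lift ord0 c != c' by rewrite -c'E lift0 gtn_eqF.
  under eq_bigr do rewrite c'E.
  rewrite (bigD1 c')//= (bigD1 (lift ord0 c))//= big1 => [|t].
    by rewrite (negbTE c's) !eqxx addr0 addrC subrK.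
  by move=> /andP[/negbTE-> /negbTE->].
by rewrite (bigD1 ord0)//= big1 ?addr0// => t /negbTE ->.
Qed.

Lemma cond_prob_level_walk s k : (0 < P (level_past s k))%E ->
  cond_prob P (L k.+1 @^-1` [set s k.+1]) (level_past s k) =
  level_trans p (s k) (s k.+1).
Proof.
move=> past_gt0.
(* An event of positive probability contains some outcome, and every walk starts at level n. *)
have s0 : s 0%N = ord_max.
  have [past0|/set0P[w past]] := eqVneq (level_past s k) set0.
    by move: past_gt0; rewrite past0 measure0 ltxx.
  by rewrite -(past 0%N)// level_walk0.
rewrite /cond_prob level_walkS_past.
have past_fin : P (level_past s k) \is a fin_num.
  by apply: fin_num_measure; exact: measurable_level_past.
have past_neq0 : fine (P (level_past s k)) != 0.
  by rewrite gt_eqF// fine_gt0// past_gt0 ltey_eq past_fin.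
move: past_fin past_neq0; rewrite level_pastE// => past_fin past_neq0.
(* The numerator factors as the one-step probability times the probability of the past, which
   cancels. *)
by rewrite independent_last// prob_move fineM//= mulfK.
Qed.

End LevelWalk.

Theorem theorem6p4 (R : realType) (d : measure_display) (T : measurableType d)
    (P : probability T R) (n : nat) (n_gt1 : (1 < n)%N)
    (X : nat -> {RV P >-> kiselman n})
    (X_gen : forall j w, exists i : 'I_n, X j w = gen i)
    (X_indep : mutually_independent X)
    (X_ident : identically_distributed X) :
  let p (i : 'I_n) := fine (P (X 0%N @^-1` [set gen i])) in
  markov_chain P (fun j w => level (walk X j w))
    (level_init R n) (level_trans p).
Proof.
move=> p; split.
- exact: measurable_level_walk.
- by move=> s; rewrite mxE ler0n.
- under eq_bigr do rewrite mxE.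
  by rewrite (bigD1 ord_max)//= eqxx big1 ?addr0// => s /negbTE ->.
- exact: level_trans_ge0.
- exact: level_trans_sum.
- exact: prob_level_walk0.
- by move=> k s past; exact: cond_prob_level_walk.
Qed.
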